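(* Let $G$ and $H$ be arbitrary connected non-trivial graphs where $H$ is not a complete graph. Then $tn(G\circ H)\leq 3\cdot tn(G)$.
   Context: All graphs are finite, undirected, without loops or multiple edges; a graph is non-trivial if it has at least two vertices. The lexicographic product $G\circ H$ has vertex set $V(G)\times V(H)$, and $(g_1,h_1)$, $(g_2,h_2)$ are adjacent if either $g_1g_2\in E(G)$ or ($g_1=g_2$ and $h_1h_2\in E(H)$). For distinct non-adjacent vertices $u,v$ of a graph $F$, a tolled walk between $u$ and $v$ is a sequence of vertices $u,w_1,\ldots,w_k,v$ with $k\ge 1$ such that $w_iw_{i+1}\in E(F)$ for all $1\le i<k$, $uw_i\in E(F)$ if and only if $i=1$, and $vw_i\in E(F)$ if and only if $i=k$. If $uv\in E(F)$, the only tolled walk between $u$ and $v$ is $u,v$; the only tolled walk from $v$ to $v$ is $v$ itself. The toll interval $T_F(u,v)$ is the set of all vertices lying on some tolled walk between $u$ and $v$. A set $S\subseteq V(F)$ is a toll set of $F$ if $\bigcup_{u,v\in S}T_F(u,v)=V(F)$. The toll number $tn(F)$ is the minimum size of a toll set of $F$. *)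

(* Defs.v *)
From mathcomp Require Import all_boot boolp.

Set Implicit Arguments.
Unset Strict Implicit.
Unset Printing Implicit Defensive.

Record sgraph := SGraph {
  vertex :> finType;
  adj : rel vertex;
  adj_sym : symmetric adj;
  adj_irrefl : irreflexive adj
}.

Definition nontrivial (F : sgraph) : Prop := 2 <= #|F|.

Definition connected (F : sgraph) : Prop :=
  forall x y : F, connect (@adj F) x y.

Definition complete (F : sgraph) : Prop :=
  forall x y : F, x != y -> adj x y.

Section Lexicographic.
Variables G H : sgraph.

Definition lex_adj (x y : G * H) : bool :=
  adj x.1 y.1 || ((x.1 == y.1) && adj x.2 y.2).

Lemma lex_adj_sym : symmetric lex_adj.
Proof.
by move=> x y; rewrite /lex_adj adj_sym eq_sym (adj_sym x.2).
Qed.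

Lemma lex_adj_irrefl : irreflexive lex_adj.
Proof. by move=> x; rewrite /lex_adj !adj_irrefl andbF. Qed.

Definition lex_product : sgraph := SGraph lex_adj_sym lex_adj_irrefl.
End Lexicographic.

Section Toll.
Variable F : sgraph.
Implicit Types (u v x : F) (S : {set F}).

(* [tolled_walk u v s]: the full vertex sequence s, endpoints included, is a
   tolled walk between u and v.  In the last case w = w_1, ..., w_k is indexed
   from 0, so w_1 and w_k are at positions 0 and (size w).-1. *)
Inductive tolled_walk u v : seq F -> Prop :=
| TolledTrivial of u = v : tolled_walk u v [:: v]
| TolledEdge of adj u v : tolled_walk u v [:: u; v]
| TolledWalk w of u != v & ~~ adj u v & 1 <= size w & sorted (@adj F) w
    & (forall i, i < size w -> adj u (nth u w i) = (i == 0))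
    & (forall i, i < size w -> adj v (nth v w i) = (i == (size w).-1)) :
    tolled_walk u v (u :: rcons w v).

Definition toll_interval u v : {set F} :=
  [set x | `[< exists2 s, tolled_walk u v s & x \in s >]].

Definition toll_set S : bool :=
  \bigcup_(u in S) \bigcup_(v in S) toll_interval u v == [set: F].

Lemma toll_setT : toll_set [set: F].
Proof.
rewrite /toll_set eqEsubset subsetT; apply/subsetP=> x _.
apply/bigcupP; exists x; rewrite ?inE //.
apply/bigcupP; exists x; rewrite ?inE //.
by apply/asboolP; exists [:: x]; [exact: TolledTrivial | rewrite mem_head].
Qed.

(* The minimum is a genuine one, by [toll_setT]. *)
Definition toll_number : nat :=
  #|[arg min_(S < [set: F] | toll_set S) #|S|]|.

Lemma toll_numberP :
  (exists2 S, toll_set S & #|S| = toll_number) /\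
  (forall S, toll_set S -> toll_number <= #|S|).
Proof.
rewrite /toll_number; case: arg_minnP => [|S tS minS]; first exact: toll_setT.
by split=> [|S' /minS //]; exists S.
Qed.
End Toll.

(* Main.v *)
Require Import Defs.
From mathcomp Require Import all_boot boolp.

(** Fix non-adjacent [h1 != h2] in [H], a minimum toll set [S] of [G] and, for
    every [s] in [S], a neighbour [t s].  The set consisting of the vertices
    [(s, h1)], [(t s, h1)] and [(t s, h2)], for [s] in [S], has at most [3 * #|S|]
    elements; it is a toll set of the product because of two kinds of walks.

    - Outside the fibres over [S] ([toll_interval_lex]): a vertex [x] of [G]
      outside [S] lies on a tolled walk of [G] between some [u] and [v] in [S].
      The section of the first projection that picks [h] over [x] and [h1] over
      every other vertex embeds [G] as an induced subgraph, so it carries this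
      walk to a tolled walk from [(u, h1)] to [(v, h1)] through [(x, h)].
    - On the fibres over [S] ([toll_interval_fibre]): [(s, h)] is adjacent to
      both [(t s, h1)] and [(t s, h2)], which are not adjacent to each other, so
      it is the middle of a tolled walk between them.  The vertices over [t s]
      are there for this purpose: if [s] has no neighbour in [S] and is interior
      to no walk between vertices of [S], walks that start at [(s, h1)] may
      fail to visit the rest of the fibre over [s]. *)

Set Implicit Arguments.
Unset Strict Implicit.
Unset Printing Implicit Defensive.

Lemma toll_setP (F : sgraph) (S : {set F}) :
  reflect (forall x, exists u v, [/\ u \in S, v \in S & x \in toll_interval u v])
          (toll_set S).
Proof.
apply: (iffP eqP) => [tS x | tS].
  have := in_setT x; rewrite -tS => /bigcupP[u uS /bigcupP[v vS xuv]].
  by exists u, v.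
apply/setP=> x; rewrite inE; have [u [v [uS vS xuv]]] := tS x.
by apply/bigcupP; exists u => //; apply/bigcupP; exists v.
Qed.

Lemma exists_neighbour (F : sgraph) (x : F) :
  connected F -> nontrivial F -> exists y, adj x y.
Proof.
move=> cF ntF; have /card_gt0P[z] : 0 < #|predC1 x|.
  by rewrite cardC1 -subn1 subn_gt0.
rewrite inE => zx; have /connectP[[|y p] /=] := cF x z.
  by move=> _ zE; rewrite zE eqxx in zx.
by case/andP=> xy _ _; exists y.
Qed.

Lemma not_complete_pair (F : sgraph) :
  ~ complete F -> exists x y : F, x != y /\ ~~ adj x y.
Proof.
move=> ncF; apply: contrapT => no_pair; apply: ncF => x y xy.
by apply/negPn/negP=> nxy; apply: no_pair; exists x, y.
Qed.

Section InducedEmbedding.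
Variables (F K : sgraph) (f : F -> K).
Hypotheses (f_inj : injective f) (f_adj : {mono f : x y / adj x y}).

(** Being a tolled walk only involves equality and adjacency between vertices
    of the walk, and an induced embedding preserves and reflects both. *)
Lemma tolled_walk_map u v s :
  tolled_walk u v s -> tolled_walk (f u) (f v) (map f s).
Proof.
case=> [uv | uv | w uv nuv w0 ws wu wv] /=.
- by apply: TolledTrivial; rewrite uv.
- by apply: TolledEdge; rewrite f_adj.
rewrite map_rcons; apply: TolledWalk; rewrite ?size_map ?f_adj ?inj_eq //.
- by rewrite sorted_map (eq_sorted (e' := @adj F)) // => x y; exact: f_adj.
- by move=> i iw; rewrite (nth_map u) // f_adj wu.
- by move=> i iw; rewrite (nth_map v) // f_adj wv.
Qed.

Lemma toll_interval_map u v x :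
  x \in toll_interval u v -> f x \in toll_interval (f u) (f v).
Proof.
rewrite !inE => /asboolP[s uvs xs]; apply/asboolP.
by exists (map f s); [exact: tolled_walk_map | exact: map_f].
Qed.
End InducedEmbedding.

Lemma toll_interval_middle (F : sgraph) (u v x : F) :
  u != v -> ~~ adj u v -> adj u x -> adj v x -> x \in toll_interval u v.
Proof.
move=> uv nuv ux vx; rewrite inE; apply/asboolP.
exists (u :: rcons [:: x] v); last by rewrite !inE eqxx orbT.
by apply: TolledWalk => // -[].
Qed.

Section Lexicographic.
Variables G H : sgraph.
Notation GH := (lex_product G H).

(** A section of the first projection is an induced embedding: whatever the
    second coordinates, vertices over distinct vertices of [G] are adjacent
    exactly when their projections are. *)
Lemma lex_section_adj (c : G -> H) :
  {mono (fun g => (g, c g) : GH) : x y / adj x y}.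
Proof.
move=> x y; rewrite /= /lex_adj /=; case: eqP => [->|_]; last by rewrite orbF.
by rewrite !adj_irrefl.
Qed.

(** The hypotheses on [x] let a section take the value [h] at [x] without
    moving the endpoints away from [h1]. *)
Lemma toll_interval_lex (u v x : G) (h1 h : H) :
  x != u -> x != v -> x \in toll_interval u v ->
  (x, h) \in toll_interval ((u, h1) : GH) (v, h1).
Proof.
move=> xu xv xuv; pose c y := if y == x then h else h1.
have c_inj : injective (fun g => (g, c g) : GH) by move=> y z [].
have := toll_interval_map c_inj (lex_section_adj c) xuv.
by rewrite /c eqxx ![_ == x]eq_sym (negPf xu) (negPf xv).
Qed.

Lemma toll_interval_fibre (s t : G) (h1 h2 h : H) :
  adj s t -> h1 != h2 -> ~~ adj h1 h2 ->
  (s, h) \in toll_interval ((t, h1) : GH) (t, h2).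
Proof.
rewrite adj_sym => ts h12 nh12; apply: toll_interval_middle.
- by apply: contraNneq h12 => -[->].
- by rewrite /= /lex_adj /= adj_irrefl eqxx.
- by rewrite /= /lex_adj /= ts.
- by rewrite /= /lex_adj /= ts.
Qed.

Lemma toll_set_lex (S : {set G}) (t : G -> G) (h1 h2 : H) :
  toll_set S -> (forall s, adj s (t s)) -> h1 != h2 -> ~~ adj h1 h2 ->
  toll_set ([set (s, h1) | s in S] :|: [set (t s, h1) | s in S]
            :|: [set (t s, h2) | s in S] : {set GH}).
Proof.
move=> /toll_setP tS t_adj h12 nh12; apply/toll_setP=> -[x h].
have [xS | xNS] := boolP (x \in S).
  exists (t x, h1), (t x, h2); split; last exact: toll_interval_fibre.
  - by rewrite !inE (imset_f (fun s => (t s, h1))) ?orbT.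
  - by rewrite !inE (imset_f (fun s => (t s, h2))) ?orbT.
have [u [v [uS vS xuv]]] := tS x.
exists (u, h1), (v, h1); split.
- by rewrite !inE (imset_f (fun s => (s, h1))).
- by rewrite !inE (imset_f (fun s => (s, h1))).
by apply: toll_interval_lex xuv; apply: contraNneq xNS => ->.
Qed.
End Lexicographic.

Theorem theorem4p8 (G H : sgraph) :
  connected G -> nontrivial G -> connected H -> nontrivial H -> ~ complete H ->
  toll_number (lex_product G H) <= 3 * toll_number G.
Proof.
move=> cG ntG _ _ /not_complete_pair[h1 [h2 [h12 nh12]]].
have [[S tS <-] _] := toll_numberP G.
pose t s := xchoose (exists_neighbour s cG ntG).
have t_adj s : adj s (t s) by exact: xchooseP.
have [_ /(_ _ (toll_set_lex tS t_adj h12 nh12)) le_tn] :=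
  toll_numberP (lex_product G H).
apply: leq_trans le_tn _; rewrite !mulSn mul0n addn0 addnA.
apply: leq_trans (leq_card_setU _ _) _; apply: leq_add; last exact: leq_imset_card.
by apply: leq_trans (leq_card_setU _ _) _; apply: leq_add; exact: leq_imset_card.
Qed.
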